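(* Let $\mathcal{H}=(V,E)$ be a hypergraph with rank $r$, let $\mathcal{H}^*=(V^*,E^* )$ be its essential core, with incidence matrix $\mathbf{B}^*=\mathbf{B}(\mathcal{H}^* )$, and let $\mathbf{A}_{\mathcal{L}}$ be the adjacency matrix of the line multigraph $\mathcal{L}(\mathcal{H})$. For $\mathbf{y}\in\mathbb{R}^{|E^*|}$ (coordinates indexed by $E^*$), let $\widetilde{\mathbf{y}}\in\mathbb{R}^{|E|}$ denote its extension by zeros (equal to $\mathbf{y}$ on the coordinates in $E^*$ and $0$ on the coordinates in $E\setminus E^*$). Then $\mathbf{y}\mapsto\widetilde{\mathbf{y}}$ is a linear isomorphism from the null space of $\mathbf{B}^*$ onto the eigenspace of $\mathbf{A}_{\mathcal{L}}$ associated with $-r$, that is, onto $\{\mathbf{x}\in\mathbb{R}^{|E|} : \mathbf{A}_{\mathcal{L}}\mathbf{x}=-r\mathbf{x}\}$. In particular, the multiplicity $\mu$ of $-r$ as an eigenvalue of $\mathbf{A}_{\mathcal{L}}$ (with $\mu=0$ if $-r$ is not an eigenvalue) is given by $$\mu = |E^*| - \operatorname{rank}(\mathbf{B}^* ),$$ and $-r$ is an eigenvalue of $\mathbf{A}_{\mathcal{L}}$ if and only if the columns of $\mathbf{B}^*$ are linearly dependent.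
   Context: A hypergraph $\mathcal{H}=(V,E)$ consists of a finite set $V$ of vertices and a set $E$ of non-empty subsets of $V$, called hyperedges. The hypergraph $\mathcal{H}$ is assumed simple (no hyperedge has cardinality one and no hyperedge is contained in another) and connected (any two vertices are joined by a path, i.e. an alternating sequence of distinct vertices and hyperedges in which each hyperedge contains the vertices immediately before and after it). The rank of $\mathcal{H}$ is the largest cardinality of its hyperedges (so $E\neq\emptyset$ when the rank is mentioned). The line multigraph $\mathcal{L}(\mathcal{H})$ is the multigraph with vertex set $E$ in which two distinct vertices $e,f\in E$ are joined by exactly $|e\cap f|$ edges (no loops). The adjacency matrix of a multigraph has zero diagonal, and for $u\neq v$ its $(u,v)$ entry is the number of edges joining $u$ and $v$. The incidence matrix $\mathbf{B}(\mathcal{H})$ is the $|V|\times|E|$ matrix with $(v,e)$ entry $1$ if $v\in e$ and $0$ otherwise. A sub-hypergraph $(V',E')$ of $\mathcal{H}$ satisfies $V'\subseteq V$, $E'\subseteq E$ and $e\subseteq V'$ for all $e\in E'$; sub-hypergraphs need not be connected. Let $E_{[r]}=\{e\in E: |e|=r\}$. A family $F\subseteq E_{[r]}$ is doubly covering if every vertex belonging to a member of $F$ belongs to at least two members of $F$. Since unions of doubly covering families are doubly covering, there is a unique maximal doubly covering family, denoted $E^*$. The essential core of $\mathcal{H}$ is the sub-hypergraph $\mathcal{H}^*=(V^*,E^* )$ with $V^*=\bigcup_{e\in E^*}e$; it may be empty. *)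

(* Defs.v *)
From mathcomp Require Import all_boot all_order all_algebra.
From mathcomp Require Import reals.

Set Implicit Arguments.
Unset Strict Implicit.
Unset Printing Implicit Defensive.

Import GRing.Theory.

Local Open Scope ring_scope.

(* The finite type [T] is only an ambient supply of points; the vertex set is
   a field, so that sub-hypergraphs are hypergraphs over the same [T]. *)
Record hypergraph (T : finType) := Hypergraph {
  verts : {set T};
  edges : {set {set T}};
  edges_sub : [forall e in edges, e \subset verts];
  edges_neq0 : set0 \notin edges
}.

Section Hypergraphs.
Variable T : finType.
Implicit Types (H : hypergraph T) (F : {set {set T}}).

Definition simple_hypergraph H :=
  [forall e in edges H, #|e| != 1%N] &&
  [forall e in edges H, forall f in edges H, (e \subset f) ==> (e == f)].

(* [:: (e1, x1); ...; (ek, xk)] encodes x, e1, x1, ..., ek, xk. *)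
Fixpoint hwalk H (x : T) (p : seq ({set T} * T)) : bool :=
  if p is (e, y) :: p' then
    [&& e \in edges H, x \in e, y \in e & hwalk H y p']
  else true.

Definition hpath H x p :=
  [&& hwalk H x p, uniq (x :: unzip2 p) & uniq (unzip1 p)].

Definition connected_hypergraph H : Prop :=
  {in verts H &, forall x y, exists2 p, hpath H x p & last x (unzip2 p) = y}.

Definition hrank H : nat := \max_(e in edges H) #|e|.

Definition sub_hypergraph H' H :=
  (verts H' \subset verts H) && (edges H' \subset edges H).

Definition edges_of_card H (k : nat) : {set {set T}} :=
  [set e in edges H | #|e| == k].

Definition doubly_covering F :=
  [forall v in cover F, (1 < #|[set e in F | v \in e]|)%N].

(* The union of all doubly covering families of edges of maximal cardinality; by
   [essential_edges_max] below, it is the unique maximal one. *)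
Definition essential_edges H : {set {set T}} :=
  \bigcup_(F : {set {set T}} |
            (F \subset edges_of_card H (hrank H)) && doubly_covering F) F.

Lemma essential_edges_sub_card H :
  essential_edges H \subset edges_of_card H (hrank H).
Proof. by apply/bigcupsP => F /andP[]. Qed.

Lemma essential_edges_sub H : essential_edges H \subset edges H.
Proof.
apply: subset_trans (essential_edges_sub_card H) _.
by apply/subsetP => e; rewrite inE => /andP[].
Qed.

Lemma essential_edges_covering H : doubly_covering (essential_edges H).
Proof.
apply/forall_inP => v /bigcupP[e /bigcupP[F PF eF] ve].
have /andP[_ /forall_inP/(_ v) dF] := PF.
have vF : v \in cover F by apply/bigcupP; exists e.
apply: leq_trans (dF vF) (subset_leq_card _).
apply/subsetP => f; rewrite !inE => /andP[fF ->]; rewrite andbT.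
by apply/bigcupP; exists F.
Qed.

Lemma essential_edges_max H F :
  maxset (fun G => (G \subset edges_of_card H (hrank H)) && doubly_covering G) F
    = (F == essential_edges H).
Proof.
have PE : (essential_edges H \subset edges_of_card H (hrank H)) &&
          doubly_covering (essential_edges H).
  by rewrite essential_edges_sub_card essential_edges_covering.
apply/maxsetP/eqP => [[PF maxF] | ->].
  by apply/esym/maxF => //; apply: (bigcup_sup F PF).
split=> // G PG sEG; apply/eqP; rewrite eqEsubset sEG andbT.
exact: (bigcup_sup G PG).
Qed.

Lemma essential_core_subP H :
  [forall e in essential_edges H, e \subset cover (essential_edges H)].
Proof. by apply/forall_inP => e eE; exact: (bigcup_sup e eE). Qed.

Lemma essential_core_neq0 H : set0 \notin essential_edges H.
Proof. exact: contra (subsetP (essential_edges_sub H) _) (edges_neq0 H). Qed.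

Definition essential_core H : hypergraph T :=
  Hypergraph (essential_core_subP H) (essential_core_neq0 H).

Lemma essential_core_sub H : sub_hypergraph (essential_core H) H.
Proof.
rewrite /sub_hypergraph /= essential_edges_sub andbT.
apply/bigcupsP => e /(subsetP (essential_edges_sub H)) eE.
by have /forall_inP/(_ e eE) := edges_sub H.
Qed.

End Hypergraphs.

(* [mult] is only meaningful on vertices; loops are excluded. *)
Record multigraph (X : finType) := Multigraph {
  mverts : {set X};
  mult : X -> X -> nat;
  mult_sym : forall u v, mult u v = mult v u;
  mult_loopless : forall u, mult u u = 0%N
}.

Section LineMultigraph.
Variables (T : finType) (H : hypergraph T).

Definition line_mult (e f : {set T}) : nat :=
  if e == f then 0%N else #|e :&: f|.

Lemma line_mult_sym e f : line_mult e f = line_mult f e.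
Proof. by rewrite /line_mult eq_sym setIC. Qed.

Lemma line_mult_loopless e : line_mult e e = 0%N.
Proof. by rewrite /line_mult eqxx. Qed.

Definition line_multigraph : multigraph {set T} :=
  Multigraph (edges H) line_mult_sym line_mult_loopless.

End LineMultigraph.

(* Rows and columns of matrices, and coordinates of vectors, are indexed by the
   elements of a finite set [S] through [enum_val : 'I_#|S| -> _]. *)

Definition adjacency_mx (R : realType) (X : finType) (G : multigraph X) :
    'M[R]_#|mverts G| :=
  \matrix_(i < #|mverts G|, j < #|mverts G|)
    (mult G (enum_val i) (enum_val j))%:R.

Definition incidence_mx (R : realType) (T : finType) (H : hypergraph T) :
    'M[R]_(#|verts H|, #|edges H|) :=
  \matrix_(i < #|verts H|, j < #|edges H|)
    (enum_val i \in (enum_val j : {set T}))%:R.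

(* The coordinate at [x] of a vector indexed by [F], read as 0 outside [F]. *)
Definition coord_at (R : realType) (X : finType) (F : {set X})
    (y : 'cV[R]_#|F|) (x : X) : R :=
  if [pick j : 'I_#|F| | enum_val j == x] is Some j then y j 0 else 0.

Definition extend0 (R : realType) (X : finType) (F E : {set X})
    (y : 'cV[R]_#|F|) : 'cV[R]_#|E| :=
  \col_(i < #|E|) coord_at y (enum_val i).

Definition null_space (R : realType) (m n : nat) (M : 'M[R]_(m, n)) :
    {pred 'cV[R]_n} :=
  [pred y | M *m y == 0].

(* The library's [eigenspace] is made of row vectors; this one is made of
   column vectors. *)
Definition col_eigenspace (R : realType) (n : nat) (A : 'M[R]_n) (a : R) :
    {pred 'cV[R]_n} :=
  [pred x | A *m x == a *: x].

Definition linear_iso_onto (R : realType) (m n : nat)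
    (f : 'cV[R]_m -> 'cV[R]_n) (U : {pred 'cV[R]_m}) (W : {pred 'cV[R]_n}) :
    Prop :=
  [/\ linear f, {in U, forall y, f y \in W}, {in U &, injective f}
    & {in W, forall x, exists2 y, y \in U & f y = x}].

Definition lin_dep_columns (R : realType) (m n : nat) (M : 'M[R]_(m, n)) : bool :=
  ~~ free [tuple col j M | j < n].

(* Main.v *)
(* Let B be the incidence matrix of H and D the diagonal matrix of the edge sizes,
   so that B^T B = A + D. If A x = - r x then
     |B x|^2 + sum_e (r - |e|) x_e^2 = 0,
   and both terms are nonnegative; hence B x = 0 and x lives on the edges of size
   r. Since B x = 0, no vertex lies in exactly one edge of the support of x, so
   this support is doubly covering and contained in E*. The algebraic multiplicity
   equals the geometric one because, A being symmetric, the kernel and the image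
   of A + r meet trivially. *)

Require Import Defs.
From mathcomp Require Import all_boot all_order all_algebra.
From mathcomp Require Import reals.

Import GRing.Theory.
Import Order.TTheory Num.Theory.

Local Open Scope ring_scope.

(** * Algebraic versus geometric multiplicity, and column dependence *)

(** The sizes are equal only propositionally because [P] will be a basis stacked from two blocks,
    whose row count is a sum of ranks. *)
Lemma char_poly_similar {F : fieldType} {m n : nat} (P : 'M[F]_(m, n))
    (A : 'M[F]_n) (B : 'M[F]_m) :
  m = n -> row_full P -> P *m A = B *m P -> char_poly A = char_poly B.
Proof.
move=> emn; case: _ / emn P A => P A; rewrite row_full_unit => uP PA.
rewrite -[A](mulKmx uP) PA /char_poly.
have uPX : map_mx polyC P \in unitmx by rewrite map_unitmx.
rewrite /char_poly_mx !map_mxM /= map_invmx.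
have -> : 'X%:M - invmx (map_mx polyC P) *m (map_mx polyC B *m map_mx polyC P) =
    invmx (map_mx polyC P) *m ('X%:M - map_mx polyC B) *m map_mx polyC P.
  by rewrite mulmxBr mulmxBl mulmxA scalar_mxC mulmxKV.
by rewrite !det_mulmx mulrAC -det_mulmx mulVmx // det1 mul1r.
Qed.

(** The kernel and the image of [A - a%:M] are stable under [A] and, by rank-nullity, complementary.
    In a basis adapted to them [A] is block diagonal, with blocks [a%:M] and [D]. An eigenvector of
    [D] for [a] would yield a nonzero vector in both spaces, so only the first block contributes to
    the multiplicity. *)
Lemma mup_char_poly {F : fieldType} {n : nat} (A : 'M[F]_n) (a : F) :
  (eigenspace A a :&: (A - a%:M) = 0)%MS ->
  mup a (char_poly A) = \rank (eigenspace A a).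
Proof.
set K := eigenspace A a; set C := A - a%:M => KC0.
pose P := col_mx (row_base K) (row_base C).
have rKC : (\rank K + \rank C)%N = n.
  by rewrite mxrank_ker subnK // rank_leq_row.
have KA : row_base K *m A = a%:M *m row_base K.
  by rewrite mul_scalar_mx; apply/eigenspaceP; rewrite eq_row_base.
have /submxP[D CA] : (row_base C *m A <= row_base C)%MS.
  rewrite -[A](subrK a%:M) mulmxDr -/C addmx_sub //.
    by rewrite eq_row_base submxMl.
  by rewrite mul_mx_scalar scalemx_sub.
have fP : row_full P.
  rewrite /row_full -addsmxE.
  have -> : \rank (row_base K + row_base C)%MS = \rank (K + C)%MS.
    by apply: eqmx_rank; apply/eqmxP; apply: adds_eqmx; apply: eq_row_base.
  by rewrite mxrank_disjoint_sum // rKC.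
have PA : P *m A = block_mx a%:M 0 0 D *m P.
  by rewrite mul_col_mx mul_block_col !mul0mx addr0 add0r KA CA.
rewrite (char_poly_similar P A _ rKC fP PA) /char_poly char_block_diag_mx det_ublock.
have nD : ~~ root (char_poly D) a.
  rewrite -eigenvalue_root_char; apply/eigenvalueP => -[v vD].
  case/negP; have : (v *m row_base C <= K :&: C)%MS.
    have vC : (v *m row_base C <= C)%MS.
      by apply: submx_trans (submxMl _ _) _; rewrite eq_row_base.
    rewrite sub_capmx vC andbT.
    by apply/eigenspaceP; rewrite -mulmxA CA mulmxA vD scalemxAl.
  rewrite KC0 submx0 => /eqP v0; apply/eqP.
  by apply: (row_free_inj (row_base_free C)); rewrite v0 mul0mx.
rewrite mupMl // -/(char_poly _) char_poly_trig ?scalar_mx_is_trig //.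
under eq_bigr => i _ do rewrite mxE eqxx.
by rewrite prodr_const card_ord mup_XsubCX eqxx.
Qed.

Lemma mulmx_tr_eq0 {R : realDomainType} {n : nat} (w : 'rV[R]_n) :
  w *m w^T = 0 -> w = 0.
Proof.
move=> /matrixP/(_ 0 0); rewrite !mxE => /eqP.
rewrite psumr_eq0 => [/allP w0|i _]; last by rewrite mxE -expr2 sqr_ge0.
apply/rowP => i; rewrite mxE; apply/eqP.
by have := w0 i (mem_index_enum i); rewrite /= mxE mulf_eq0 orbb.
Qed.

(** With [C = A - a%:M] symmetric, [w *m C = 0] and [w = u *m C] give
    [w *m w^T = w *m C *m u^T = 0], hence [w = 0]. *)
Lemma mup_char_poly_sym {R : realFieldType} {n : nat} (A : 'M[R]_n) (a : R) :
  A^T = A -> mup a (char_poly A) = \rank (eigenspace A a).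
Proof.
move=> symA; apply: mup_char_poly; apply/eqP/rowV0P => w.
rewrite sub_capmx => /andP[/sub_kermxP wC0 /submxP[u wE]].
apply: mulmx_tr_eq0; rewrite [in X in _ *m X]wE trmx_mul linearB /= symA.
by rewrite tr_scalar_mx mulmxA wC0 mul0mx.
Qed.

Lemma lin_dep_columnsE {R : realType} {m n : nat} (M : 'M[R]_(m, n)) :
  lin_dep_columns M = (\rank M != n).
Proof.
rewrite /lin_dep_columns -mxrank_tr; congr (~~ _).
rewrite -[RHS]/(row_free M^T) -kermx_eq0.
have colM (k : 'rV[R]_n) :
    \sum_(i < n) k 0 i *: [tuple col j M | j < n]`_i = (k *m M^T)^T.
  rewrite trmx_mul trmxK; apply/colP => i; rewrite summxE mxE.
  by apply: eq_bigr => j _; rewrite mxE -tnth_nth tnth_mktuple !mxE mulrC.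
apply/freeP/rowV0P => [fM k /sub_kermxP k0 | K0 k k0 i].
  by apply/rowP => i; rewrite (fM (k 0)) ?mxE // colM k0 trmx0.
have : (\row_i k i <= kermx M^T)%MS.
  apply/sub_kermxP/trmx_inj; rewrite -colM trmx0 -[RHS]k0.
  by apply: eq_bigr => j _; rewrite mxE.
by move/K0/rowP/(_ i); rewrite !mxE.
Qed.

(** * Vectors indexed by a finite set, read as functions on the ambient type *)

Section Coordinates.
Context {R : realType} {X : finType} {F : {set X}}.
Implicit Type y : 'cV[R]_#|F|.

Lemma coord_at_enum_val y j : coord_at y (enum_val j) = y j 0.
Proof.
rewrite /coord_at; case: pickP => [i /eqP/enum_val_inj-> //|/(_ j)].
by rewrite eqxx.
Qed.

Lemma coord_at_notin y x : x \notin F -> coord_at y x = 0.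
Proof.
rewrite /coord_at; case: pickP => // i /eqP<- /negP[]; exact: enum_valP.
Qed.

Lemma coord_at_inj y z : {in F, coord_at y =1 coord_at z} -> y = z.
Proof.
move=> yz; apply/colP => j; rewrite -!coord_at_enum_val; apply: yz.
exact: enum_valP.
Qed.

Lemma coord_atD a y z x :
  coord_at (a *: y + z) x = a * coord_at y x + coord_at z x.
Proof.
have [xF|xF] := boolP (x \in F); last by rewrite !coord_at_notin // mulr0 addr0.
by rewrite -(enum_rankK_in xF xF) !coord_at_enum_val !mxE.
Qed.

Lemma coord_at_col (c : X -> R) x :
  x \in F -> coord_at (\col_(j < #|F|) c (enum_val j)) x = c x.
Proof.
by move=> xF; rewrite -(enum_rankK_in xF xF) coord_at_enum_val mxE.
Qed.

Lemma sum_coord_at y (G : X -> R) :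
  \sum_(j < #|F|) G (enum_val j) * y j 0 = \sum_(x in F) G x * coord_at y x.
Proof.
rewrite [RHS]big_enum_val /=.
by apply: eq_bigr => j _; rewrite coord_at_enum_val.
Qed.

End Coordinates.

(** * Extension by zero and its effect on dimensions *)

Section Extend0.
Context {R : realType} {X : finType} {F : {set X}}.
Implicit Type y : 'cV[R]_#|F|.

Lemma coord_at_extend0 (E : {set X}) y :
  F \subset E -> coord_at (extend0 E y) =1 coord_at y.
Proof.
move=> sFE x; have [xE|xE] := boolP (x \in E).
  exact: coord_at_col.
rewrite !coord_at_notin //; exact: contra (subsetP sFE x) xE.
Qed.

Lemma extend0_linear (E : {set X}) : linear (@extend0 R X F E).
Proof. by move=> a y z; apply/colP => i; rewrite !mxE coord_atD. Qed.

Lemma extend0_inj (E : {set X}) : F \subset E -> injective (@extend0 R X F E).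
Proof.
move=> sFE y z yz; apply: coord_at_inj => x _.
by rewrite -(coord_at_extend0 _ _ sFE) yz coord_at_extend0.
Qed.

(** Extension by zero as a matrix acting on row vectors from the right, the convention of [kermx]
    and [eigenspace]. *)
Definition extend0_mx (E : {set X}) : 'M[R]_(#|F|, #|E|) :=
  \matrix_(i < #|F|, j < #|E|) (enum_val i == enum_val j)%:R.

Lemma tr_extend0 (E : {set X}) y : (extend0 E y)^T = y^T *m extend0_mx E.
Proof.
apply/rowP => j; rewrite !mxE.
under eq_bigr => i _ do rewrite !mxE mulrC.
rewrite (sum_coord_at y (fun x => (x == enum_val j)%:R)).
have [jF|jF] := boolP (enum_val j \in F).
  rewrite (bigD1 (enum_val j)) //= eqxx mul1r big1 ?addr0 // => x /andP[_].
  by move=> /negPf->; rewrite mul0r.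
rewrite coord_at_notin // big1 // => x xF; case: eqP => [xj|_]; last first.
  by rewrite mul0r.
by rewrite -xj xF in jF.
Qed.

(** Transposition turns the null space of [M] into [kermx M^T] and, [A] being symmetric, the column
    eigenspace into [eigenspace A a]. The isomorphism then says that [extend0_mx E] maps the former
    injectively onto the latter. *)
Lemma rank_eigenspace_extend0 (E : {set X}) (p : nat) (M : 'M[R]_(p, #|F|))
    (A : 'M[R]_#|E|) (a : R) :
  A^T = A ->
  linear_iso_onto (@extend0 R X F E) (null_space M) (col_eigenspace A a) ->
  \rank (eigenspace A a) = (#|F| - \rank M)%N.
Proof.
move=> symA [_ mapU injU ontoW].
have trU (w : 'rV_#|F|) : (w <= kermx M^T)%MS = (w^T \in null_space M).
  by rewrite inE sub_kermx -(inj_eq trmx_inj) trmx_mul trmxK trmx0.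
have trW (u : 'rV_#|E|) : (u <= eigenspace A a)%MS = (u^T \in col_eigenspace A a).
  rewrite inE (sameP eigenspaceP eqP) -(inj_eq trmx_inj) trmx_mul symA.
  by rewrite linearZ.
have <- : \rank (kermx M^T) = (#|F| - \rank M)%N by rewrite mxrank_ker mxrank_tr.
(* Injectivity on the null space means that [kermx M^T] meets the kernel of [extend0_mx E]
   trivially, so the rank is preserved. *)
have <- : \rank (kermx M^T *m extend0_mx E) = \rank (kermx M^T).
  apply/mxrank_injP/rowV0P => w; rewrite sub_capmx trU => /andP[wU /sub_kermxP].
  rewrite -{1}[w]trmxK -tr_extend0 => w0; apply: trmx_inj.
  apply: injU; rewrite // ?inE ?trmx0 ?mulmx0 //; apply: trmx_inj.
  by rewrite w0 tr_extend0 trmx0 mul0mx.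
apply: eqmx_rank; apply/andP; split; apply/rV_subP => u.
  rewrite trW => /ontoW[y yU yu]; rewrite -[u]trmxK -yu tr_extend0 submxMr //.
  by rewrite trU trmxK.
move=> /submxP[w ->]; rewrite mulmxA trW -[w *m _]trmxK -tr_extend0 trmxK.
by apply: mapU; rewrite -trU submxMl.
Qed.

End Extend0.

(** * Eigenvectors of the line multigraph for the eigenvalue [-r] *)

Section LineEigenspace.
Context {R : realType} {T : finType}.
Implicit Types (H : hypergraph T) (E : {set {set T}}) (c : {set T} -> R).

(** This is the coordinate at [v] of B c; taking [c] as a function on all sets lets the family [E]
    vary. *)
Definition vertex_sum E c (v : T) : R := \sum_(e in E | v \in e) c e.

Lemma null_space_incidenceP H (y : 'cV[R]_#|edges H|) :
  reflect (forall v, vertex_sum (edges H) (coord_at y) v = 0)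
          (y \in null_space (incidence_mx R H)).
Proof.
have BE i : (incidence_mx R H *m y) i 0 =
    vertex_sum (edges H) (coord_at y) (enum_val i).
  rewrite mxE; under eq_bigr => j _ do rewrite mxE.
  rewrite (sum_coord_at y (fun e : {set T} => (enum_val i \in e)%:R)).
  rewrite /vertex_sum big_mkcondr; apply: eq_bigr => e _.
  by case: ifP; rewrite ?mul1r ?mul0r.
rewrite inE; apply: (iffP eqP) => [By0 v | S0]; last first.
  by apply/colP => i; rewrite BE S0 mxE.
have [vH|vH] := boolP (v \in verts H).
  by rewrite -(enum_rankK_in vH vH) -BE By0 mxE.
(* A point outside the vertex set lies in no edge, so its sum is empty. *)
rewrite /vertex_sum big1 // => e /andP[eH ve]; case/negP: vH.
by have /forall_inP/(_ e eH)/subsetP/(_ v ve) := edges_sub H.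
Qed.

Lemma col_eigenspace_lineP H (a : R) (x : 'cV[R]_#|edges H|) :
  reflect {in edges H, forall e,
             \sum_(f in edges H) (line_mult e f)%:R * coord_at x f =
             a * coord_at x e}
          (x \in col_eigenspace (adjacency_mx R (line_multigraph H)) a).
Proof.
have AE i : (adjacency_mx R (line_multigraph H) *m x) i 0 =
    \sum_(f in edges H) (line_mult (enum_val i) f)%:R * coord_at x f.
  rewrite mxE; under eq_bigr => j _ do rewrite mxE.
  exact: (sum_coord_at x (fun f => (line_mult (enum_val i) f)%:R)).
rewrite inE; apply: (iffP eqP) => [Ax e eH | Ax].
  by rewrite -(enum_rankK_in eH eH) -AE Ax mxE coord_at_enum_val.
by apply/colP => i; rewrite AE Ax ?enum_valP // mxE coord_at_enum_val.
Qed.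

(* The identity B^T B = A + diag |e|, evaluated at c. *)
Lemma sum_vertex_sum E c e :
  e \in E ->
  \sum_(v in e) vertex_sum E c v =
  \sum_(f in E) (line_mult e f)%:R * c f + #|e|%:R * c e.
Proof.
move=> eE; have -> : \sum_(v in e) vertex_sum E c v =
    \sum_(f in E) #|e :&: f|%:R * c f.
  rewrite /vertex_sum (exchange_big_dep (mem E)) /= => [|v f _ /andP[] //].
  apply: eq_bigr => f fE.
  rewrite (eq_bigl (mem (e :&: f))) => [|v]; last by rewrite !inE fE.
  by rewrite sumr_const mulr_natl.
rewrite (bigD1 e) //= [in RHS](bigD1 e) //= /line_mult eqxx mul0r add0r setIid.
rewrite addrC; congr (_ + _); apply: eq_bigr => f /andP[_ fe].
by rewrite eq_sym (negPf fe).
Qed.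

(** This is |B c|^2 = c^T (B^T B c), by exchanging the two summations. *)
Lemma sum_sqr_vertex_sum E c :
  \sum_v vertex_sum E c v ^+ 2 =
  \sum_(e in E) c e * \sum_(v in e) vertex_sum E c v.
Proof.
under [RHS]eq_bigr => e _ do rewrite mulr_sumr.
rewrite (exchange_big_dep predT) //=; apply: eq_bigr => v _.
by rewrite expr2 {1}/vertex_sum mulr_suml.
Qed.

Lemma line_eigenvectorP E c (r : nat) :
  {in E, forall e : {set T}, (#|e| <= r)%N} ->
  {in E, forall e, \sum_(f in E) (line_mult e f)%:R * c f = - r%:R * c e} <->
  (forall v, vertex_sum E c v = 0) /\ {in E, forall e : {set T}, #|e| != r -> c e = 0}.
Proof.
move=> rE; split=> [Ac | [S0 c0] e eE].
  have gram e : e \in E ->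
      \sum_(v in e) vertex_sum E c v = - (r%:R - #|e|%:R) * c e.
    by move=> eE; rewrite sum_vertex_sum // Ac // -mulrDl opprB addrC.
  have def0 e : e \in E -> 0 <= (r%:R - #|e|%:R) * c e ^+ 2.
    by move=> eE; rewrite mulr_ge0 ?sqr_ge0 // subr_ge0 ler_nat rE.
  (* Pairing [gram] with [c] gives the vanishing sum of two nonnegative terms. *)
  have : \sum_v vertex_sum E c v ^+ 2 +
      \sum_(e in E) (r%:R - #|e|%:R) * c e ^+ 2 = 0.
    rewrite sum_sqr_vertex_sum -big_split big1 //= => e eE.
    by rewrite gram // mulrCA -expr2 mulNr addNr.
  move/eqP; rewrite paddr_eq0 ?sumr_ge0 // => [/andP[S0 D0]|v _]; last exact: sqr_ge0.
  split=> [v|e eE er].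
    move: S0; rewrite psumr_eq0 => [/allP/(_ v (mem_index_enum v))|u _].
      by rewrite /= sqrf_eq0 => /eqP.
    exact: sqr_ge0.
  move: D0; rewrite psumr_eq0 // => /allP/(_ e (mem_index_enum e)).
  by rewrite eE /= mulf_eq0 subr_eq0 eqr_nat eq_sym (negPf er) sqrf_eq0 => /eqP.
(* For the converse, adding [#|e|%:R * c e] makes the left side the coordinate of B^T B c at [e],
   which is 0. The right side becomes [(#|e| - r) * c e], where one factor vanishes. *)
apply: (addIr (#|e|%:R * c e)); rewrite -sum_vertex_sum // big1 => [|v _].
  have [-> | /(c0 e eE)->] := eqVneq #|e| r; first by rewrite mulNr addNr.
  by rewrite !mulr0 addr0.
exact: S0.
Qed.

Lemma essential_edges_support H c :
  (forall v, vertex_sum (edges H) c v = 0) ->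
  {in edges H, forall e : {set T}, #|e| != hrank H -> c e = 0} ->
  {in edges H, forall e, e \notin essential_edges H -> c e = 0}.
Proof.
move=> S0 c0 e eH; apply: contraNeq => ce.
pose F := [set f in edges H | c f != 0].
apply/bigcupP; exists F; last by rewrite inE eH.
apply/andP; split.
  apply/subsetP => f; rewrite !inE => /andP[fH cf]; rewrite fH.
  by apply: contraNT cf => /(c0 f fH)->.
apply/forall_inP => v /bigcupP[f]; rewrite inE => /andP[fH cf] vf.
(* If [f] were the only member of [F] through [v], the zero sum at [v] would reduce to [c f], which
   is nonzero. *)
rewrite ltnNge; apply: contraNN (cf) => /card_le1_eqP F1; rewrite -(S0 v).
rewrite /vertex_sum (bigD1 f) ?fH //= big1 ?addr0 // => g /andP[/andP[gH vg] gf].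
apply: contraNeq gf => cg; apply/eqP.
by apply: F1; rewrite !inE ?gH ?fH ?cg ?cf ?vf ?vg.
Qed.

Lemma vertex_sum_subset (E F : {set {set T}}) c :
  F \subset E -> {in E, forall e, e \notin F -> c e = 0} ->
  vertex_sum E c =1 vertex_sum F c.
Proof.
move=> sFE c0 v; rewrite /vertex_sum (bigID (mem F)) /= addrC big1 ?add0r.
  apply: eq_bigl => e; rewrite andbAC; congr (_ && _).
  by apply/andb_idl/(subsetP sFE).
by move=> e /andP[/andP[eE _]]; apply: c0.
Qed.

Lemma extend0_line_iso H :
  linear_iso_onto (@extend0 R _ (essential_edges H) (edges H))
    (null_space (incidence_mx R (essential_core H)))
    (col_eigenspace (adjacency_mx R (line_multigraph H)) (- (hrank H)%:R)).
Proof.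
have sFE := essential_edges_sub H.
have rE : {in edges H, forall e : {set T}, (#|e| <= hrank H)%N}.
  by move=> e eH; rewrite /hrank (bigD1 e) //= leq_maxl.
split.
- exact: extend0_linear.
- move=> y /null_space_incidenceP S0; apply/col_eigenspace_lineP.
  apply/(line_eigenvectorP (edges H)) => //.
  have c0 e : e \notin essential_edges H -> coord_at (extend0 (edges H) y) e = 0.
    by move=> eF; rewrite coord_at_extend0 // coord_at_notin.
  split=> [v|e eH er].
    rewrite (vertex_sum_subset _ _ _ sFE) => [|e _]; last exact: c0.
    rewrite -[RHS](S0 v); apply: eq_bigr => e _; exact: coord_at_extend0.
  apply: c0; apply: contra er => /(subsetP (essential_edges_sub_card H)).
  by rewrite inE => /andP[].
- by move=> y z _ _; apply: extend0_inj.
move=> x /col_eigenspace_lineP/(line_eigenvectorP _ _ _ rE)[S0 c0].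
have x0 := essential_edges_support _ _ S0 c0.
(* The preimage of [x] is its restriction to the essential edges; nothing is lost, since [x]
   vanishes on the other edges. *)
pose y : 'cV[R]_#|essential_edges H| := \col_j coord_at x (enum_val j).
have yx : coord_at (extend0 (edges H) y) =1 coord_at x.
  move=> e; rewrite coord_at_extend0 //.
  have [eF|eF] := boolP (e \in essential_edges H); first by rewrite coord_at_col.
  rewrite coord_at_notin //; have [eH|eH] := boolP (e \in edges H).
    by rewrite x0.
  by rewrite coord_at_notin.
exists y; last by apply: coord_at_inj => e _; apply: yx.
apply/null_space_incidenceP => v /=; rewrite -[RHS](S0 v).
rewrite (vertex_sum_subset _ _ _ sFE) //.
by apply: eq_bigr => e /andP[eF _]; rewrite coord_at_col.
Qed.

End LineEigenspace.

(* The matrix A is symmetric, so the algebraic multiplicity of -r (its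
   multiplicity as a root of the characteristic polynomial) and the geometric one
   (the dimension of the eigenspace) agree; the formula is stated for both. *)
Theorem theorem4p13 (R : realType) (T : finType) (H : hypergraph T) (r : nat)
    (simpleH : simple_hypergraph H) (connH : connected_hypergraph H)
    (edgesH : edges H != set0) (rankH : hrank H = r) :
  let Hs := essential_core H in
  let B : 'M[R]_(#|verts Hs|, #|edges Hs|) := incidence_mx R Hs in
  let A : 'M[R]_#|edges H| := adjacency_mx R (line_multigraph H) in
  [/\ linear_iso_onto (@extend0 R _ (edges Hs) (edges H))
        (null_space B) (col_eigenspace A (- r%:R)),
      mup (- r%:R) (char_poly A) = (#|edges Hs| - \rank B)%N,
      \rank (eigenspace A (- r%:R)) = (#|edges Hs| - \rank B)%N
    & eigenvalue A (- r%:R) <-> lin_dep_columns B].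
Proof.
move=> Hs B A; rewrite -rankH.
have iso := @extend0_line_iso R T H.
have symA : A^T = A by apply/matrixP => i j; rewrite !mxE mult_sym.
have rkA : \rank (eigenspace A (- (hrank H)%:R)) = (#|edges Hs| - \rank B)%N.
  exact: rank_eigenspace_extend0 symA iso.
split=> //; first by rewrite mup_char_poly_sym.
(* The truncated difference is nonzero exactly when [\rank B] is less than the number of columns. *)
by rewrite lin_dep_columnsE /eigenvalue -mxrank_eq0 rkA subn_eq0 -ltnNge
  ltn_neqAle rank_leq_col andbT.
Qed.
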